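(* Let $G=(\mathcal H,\mathcal V)$ be a two-dimensional graph on a finite vertex set, with adjacency matrices $H$ and $V$, and let $X_G$ be the two-dimensional shift space generated by $G$. Suppose that for all vertices $i,j$ one has $(HV)_{ij}\neq 0 \Leftrightarrow (VH)_{ij}\neq 0$. Let $r,s\in\mathbb Z$ with $rs>0$. Then $X_G$ is doubly $(r,s)$-transitive if and only if $H^rV^s$ is irreducible.
   Context: A two-dimensional graph $G=(\mathcal H,\mathcal V)$ is a pair of finite directed graphs (loops allowed, no multiple edges) on a common vertex set $A$, with $0$-$1$ adjacency matrices $H$ (for $\mathcal H$) and $V$ (for $\mathcal V$). It generates $X_G=\{x\in A^{\mathbb Z^2}: H_{x(m,n)\,x(m+1,n)}=1 \text{ and } V_{x(m,n)\,x(m,n+1)}=1 \text{ for all } (m,n)\in\mathbb Z^2\}$, with the subspace topology of the product topology on $A^{\mathbb Z^2}$ ($A$ discrete). Shift spaces (subshifts) are by definition non-empty, closed and shift-invariant. For $a\in\mathbb Z^2$, $(\sigma^a x)(k)=x(k+a)$. $X_G$ is doubly $(r,s)$-transitive if both $\sigma^{(r,s)}$ and its inverse $\sigma^{(-r,-s)}$ are transitive for positive time: for any non-empty open $U,W\subseteq X_G$ there are $k,l\in\mathbb N=\{1,2,\dots\}$ with $\sigma^{(kr,ks)}(U)\cap W\neq\emptyset$ and $\sigma^{(-lr,-ls)}(U)\cap W\neq\emptyset$. A non-negative square matrix $M$ is irreducible if for every pair of indices $i,j$ there is $k\in\mathbb N$ with $(M^k)_{ij}\neq 0$. For $r,s<0$,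 $H^rV^s$ is read as $(H^T)^{|r|}(V^T)^{|s|}$.
   Formalization: It is additionally assumed that every vertex has an incoming and an outgoing edge in both graphs; without this the ''only if'' direction fails (two vertices, H and V both having only the loop at one of them). *)

(* Defs.v *)
(* MathComp / MathComp-Analysis *)
From HB Require Import structures.
From mathcomp Require Import all_boot all_order all_algebra.
From mathcomp Require Import boolp classical_sets topology.
Set Implicit Arguments.
Unset Strict Implicit.
Unset Printing Implicit Defensive.
Import Order.TTheory GRing.Theory Num.Theory.
Local Open Scope classical_set_scope.
Local Open Scope ring_scope.

(* A relation rules out multiple edges and allows loops. *)
Record graph2 (A : finType) := Graph2 { hedge : rel A; vedge : rel A }.

(* Vertices are numbered by the canonical enumeration of A; the entries are
   naturals so that entries of products count paths. *)
Definition adjmx (A : finType) (e : rel A) : 'M[nat]_#|A| :=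
  \matrix_(i, j) (e (enum_val i) (enum_val j) : nat).

Definition hadj (A : finType) (G : graph2 A) : 'M[nat]_#|A| := adjmx (hedge G).
Definition vadj (A : finType) (G : graph2 A) : 'M[nat]_#|A| := adjmx (vedge G).

(* The notation M^r of "H^r V^s": for r < 0 this is the power |r| of the
   transpose, not of an inverse. *)
Definition adjpow n (M : 'M[nat]_n) (r : int) : 'M[nat]_n :=
  if 0 <= r then M ^+ `|r|%N else M^T ^+ `|r|%N.

(* The exponent has to be positive: the identity matrix M ^+ 0 is excluded. *)
Definition irreducible_mx n (M : 'M[nat]_n) : Prop :=
  forall i j : 'I_n, exists k : nat, (0 < k)%N /\ (M ^+ k) i j != 0.

(* No stranded vertices.  A vertex without, say, an outgoing horizontal edge
   occurs in no point of the shift space, yet contributes a zero row to H: it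
   breaks irreducibility without affecting the dynamics. *)
Definition essential_rel (A : finType) (e : rel A) : Prop :=
  forall a : A, (exists b, e a b) /\ (exists b, e b a).

Definition essential (A : finType) (G : graph2 A) : Prop :=
  essential_rel (hedge G) /\ essential_rel (vedge G).

Definition config (A : finType) : topologicalType :=
  prod_topology (fun _ : int * int => discrete_topology A).

Definition graph_shift (A : finType) (G : graph2 A) : set (config A) :=
  [set x | forall m n : int,
     hedge G (x (m, n)) (x (m + 1, n)) /\ vedge G (x (m, n)) (x (m, n + 1))].

Definition shift (A : finType) (a : int * int) (x : config A) : config A :=
  fun k => x (k + a).

(* The topology of [subspace X] makes the points outside X isolated, so the
   open sets of the subspace topology on X are its open sets contained in X. *)
Definition open_in (T : topologicalType) (X U : set T) : Prop :=
  open (U : set (subspace X)) /\ U `<=` X.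

Definition doubly_transitive (A : finType) (X : set (config A)) (r s : int)
  : Prop :=
  forall U W : set (config A),
    open_in X U -> U !=set0 -> open_in X W -> W !=set0 ->
    exists k l : nat, [/\ (0 < k)%N, (0 < l)%N,
      (shift (k%:Z * r, k%:Z * s) @` U) `&` W !=set0 &
      (shift (- (l%:Z * r), - (l%:Z * s)) @` U) `&` W !=set0].

(* Main.v *)
Require Import Defs.
From HB Require Import structures.
From mathcomp Require Import all_boot all_order all_algebra.
From mathcomp Require Import boolp classical_sets topology.
From mathcomp Require Import zify.
Import Order.TTheory GRing.Theory Num.Theory.
Local Open Scope classical_set_scope.
Local Open Scope ring_scope.
Set Implicit Arguments.
Unset Strict Implicit.

(** The hypothesis on [HV] and [VH] says that a horizontal edge followed by a
    vertical one can be exchanged for a vertical edge followed by a horizontal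
    one, and conversely.  It is used in two ways.

    Geometrically, it completes unit squares: the symbol at the south-east
    corner of a square can be chosen when the other three are known, and
    likewise the one at the north-west corner.  Hence a valid pattern on a
    region that separates the plane into a north-west and a south-east part
    extends to a point of the shift space ([extend_to_plane]), the missing cells
    being filled along the diagonals on which [p - q] is constant.  Two
    consequences: every vertex occurs in some point ([occurs_of_essential], the
    region being a staircase), and the south-west quadrant of one point can be
    joined to the north-east quadrant of another by a single edge between the
    two corners ([glue_hedge]), hence by any walk that takes horizontal edges
    and then vertical ones ([glue_walk]).

    Algebraically, [H] and [V] commute as far as the positions of the nonzero
    entries are concerned, so [(H^r V^s)^k] and [H^(rk) V^(sk)] have the same
    support ([same_support_expM]).

    For [r, s > 0], a point [x] with [x (0, 0) = i] and [x (kr, ks) = j] shows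
    that the entry [(i, j)] of [H^(rk) V^(sk)] is nonzero; since every vertex
    occurs, transitivity on the cylinders at the origin gives irreducibility.
    Conversely a basic open set prescribes the symbols in a box
    ([open_in_box]); the box of half-width [N] lies south-west of [(Nr, Ns)] and
    north-east of [(-Nr, -Ns)].  Irreducibility gives a walk of type
    [H^(rk) V^(sk)] from the symbol of the first point at [(Nr, Ns)] to the
    symbol of the second point at [(-Nr, -Ns)], and gluing along it puts the
    second box at the displacement [(k + 2N)(r, s)] from the first.

    Two reductions finish the proof.  Transitivity for [(-r, -s)] is
    transitivity for [(r, s)] with the two open sets exchanged, so double
    transitivity is one-sided transitivity ([doubly_transitiveE]) and is
    insensitive to the sign of [(r, s)]; and for negative exponents the matrix
    is the transpose of [V^|s| H^|r|], which is irreducible exactly when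
    [H^|r| V^|s|] is. *)

(** * Completing patterns along diagonals *)

(** The reflection in the diagonal of the plane exchanges the two directions; it
    turns south-east corners into north-west ones. *)
Definition transpose (A : finType) (G : graph2 A) : graph2 A :=
  Graph2 (vedge G) (hedge G).

Definition swap (A : Type) (x : int * int -> A) (c : int * int) : A := x (c.2, c.1).

(** Three sides of a unit square are met in the order west, north-west, north:
    [d] is the missing south-east corner. *)
Definition corner_fillable (A : finType) (G : graph2 A) : Prop :=
  forall a b c, vedge G a b -> hedge G b c ->
    exists d, hedge G a d /\ vedge G d c.

Definition valid_on (A : finType) (G : graph2 A) (D : pred (int * int))
    (x : int * int -> A) : Prop :=
  forall p q : int,
    (D (p, q) -> D (p + 1, q) -> hedge G (x (p, q)) (x (p + 1, q))) /\
    (D (p, q) -> D (p, q + 1) -> vedge G (x (p, q)) (x (p, q + 1))).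

Definition SE_closed (L : pred (int * int)) : Prop :=
  forall p q : int, L (p, q) -> L (p + 1, q) /\ L (p, q - 1).

Definition NW_closed (U : pred (int * int)) : Prop :=
  forall p q : int, U (p, q) -> U (p - 1, q) /\ U (p, q + 1).

(** Cells outside [L] keep the symbol that they have in [x]; a cell of [L] is
    chosen by [f] from its western and northern neighbours, which both lie on the
    previous diagonal.  The number of diagonals still to go serves as fuel. *)
Fixpoint fill (A : Type) (f : A -> A -> A) (L : pred (int * int))
    (x : int * int -> A) (n : nat) (c : int * int) : A :=
  if n is n'.+1 then
    if L c then f (fill f L x n' (c.1 - 1, c.2)) (fill f L x n' (c.1, c.2 + 1))
    else x c
  else x c.

(** The cells of [L] are filled in increasing order of [p - q].  The western,
    northern and north-western neighbours of such a cell avoid [U], so they are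
    already known and form the three sides of a completable square; the lower
    bound on [p - q] lets the recursion start. *)
Lemma fill_SE (A : finType) (G : graph2 A) (L U : pred (int * int)) (l : int)
    (x : int * int -> A) :
  corner_fillable G -> SE_closed L -> NW_closed U ->
  (forall p q, L (p, q) -> ~~ U (p - 1, q + 1)) ->
  (forall p q, L (p, q) -> l < p - q) ->
  valid_on G (fun c => ~~ L c && ~~ U c) x ->
  exists2 z, (forall c, ~~ L c -> z c = x c) & valid_on G (fun c => ~~ U c) z.
Proof.
move=> HG HL HU sep lev Hx.
pose f a c := odflt a [pick d | hedge G a d && vedge G d c].
have Hf a b c : vedge G a b -> hedge G b c -> hedge G a (f a c) /\ vedge G (f a c) c.
  move=> ab bc; have [d [ad dc]] := HG _ _ _ ab bc.
  rewrite /f; case: pickP => [e /andP[]//|/(_ d)]; by rewrite ad dc.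
(* The truncation at 0 puts every diagonal up to l, where L has no cell, at
   fuel 0, which returns x. *)
pose n (p q : int) := absz (Num.max 0 (p - q - l)).
pose z c := fill f L x (n c.1 c.2) c.
have zE p q : z (p, q) = if L (p, q) then f (z (p - 1, q)) (z (p, q + 1)) else x (p, q).
  rewrite /z /=; case: ifPn => Lpq; last by case: (n p q) => //= m; rewrite (negPf Lpq).
  have lpq := lev _ _ Lpq.
  have -> : n p q = (n (p - 1) q).+1 by rewrite /n; lia.
  have -> : n p (q + 1) = n (p - 1) q by rewrite /n; lia.
  by rewrite /= Lpq.
have zx p q : ~~ L (p, q) -> z (p, q) = x (p, q) by rewrite zE => /negPf->.
exists z => [[p q]|]; first exact: zx.
(* L is closed to the east and to the south, so the cells west and north of a
   cell outside L are outside L: x provides both ends of these edges. *)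
have known p q : ~~ L (p, q) -> ~~ U (p, q) ->
    (~~ U (p - 1, q) -> hedge G (z (p - 1, q)) (z (p, q))) /\
    (~~ U (p, q + 1) -> vedge G (z (p, q)) (z (p, q + 1))).
  move=> Lpq Upq; split=> U1.
    have L1 : ~~ L (p - 1, q) by apply: contra Lpq => /HL[]; rewrite subrK.
    have [+ _] := Hx (p - 1) q; rewrite subrK !zx //; apply; exact/andP.
  have L1 : ~~ L (p, q + 1) by apply: contra Lpq => /HL[_]; rewrite addrK.
  by have [_] := Hx p q; rewrite !zx //; apply; apply/andP.
(* Induction on the diagonal of (p, q): each edge is attached to its end with the
   larger p - q, the eastern end or the southern end. *)
have main m : forall p q : int, (n p q <= m)%N -> ~~ U (p, q) ->
    (~~ U (p - 1, q) -> hedge G (z (p - 1, q)) (z (p, q))) /\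
    (~~ U (p, q + 1) -> vedge G (z (p, q)) (z (p, q + 1))).
  elim: m => [|m IH] p q npq Upq;
    (case Lpq: (L (p, q)); last by apply: known => //; rewrite Lpq).
    by move: (lev _ _ Lpq) npq; rewrite /n; lia.
  have lpq := lev _ _ Lpq; have U3 := sep _ _ Lpq.
  have U1 : ~~ U (p - 1, q) by apply: contra U3 => /HU[].
  have U2 : ~~ U (p, q + 1) by apply: contra U3 => /HU[].
  have [|//|_ E1] := IH (p - 1) q; first by move: npq; rewrite /n; lia.
  have [|//|E2 _] := IH p (q + 1); first by move: npq; rewrite /n; lia.
  by rewrite (zE p q) Lpq; have [] := Hf _ _ _ (E1 U3) (E2 U3).
move=> p q; split=> U1 U2.
  by have [+ _] := main _ _ _ (leqnn (n (p + 1) q)) U2; rewrite addrK; apply.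
by have [_] := main _ _ _ (leqnn (n p q)) U1; apply.
Qed.

Lemma transposeK (A : finType) (G : graph2 A) : transpose (transpose G) = G.
Proof. by case: G. Qed.

Lemma valid_swap (A : finType) (G : graph2 A) D x :
  valid_on G D x -> valid_on (transpose G) (swap D) (swap x).
Proof. by move=> Hx p q; have [] := Hx q p. Qed.

Definition fillable (A : finType) (G : graph2 A) : Prop :=
  corner_fillable G /\ corner_fillable (transpose G).

Lemma fillable_transpose (A : finType) (G : graph2 A) :
  fillable G -> fillable (transpose G).
Proof. by case=> H1 H2; split; rewrite ?transposeK. Qed.

Lemma graph_shift_swap (A : finType) (G : graph2 A) (x : config A) :
  graph_shift G x -> graph_shift (transpose G) (swap x).
Proof. by move=> Hx p q; have [] := Hx q p. Qed.

(** What is prescribed outside [L] and [U] separates the plane; [L] is filled from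
    the diagonal [l] on, then [U] by the same argument after a reflection. *)
Lemma extend_to_plane (A : finType) (G : graph2 A) (L U : pred (int * int)) (l u : int)
    (x : int * int -> A) :
  fillable G -> SE_closed L -> NW_closed U ->
  (forall p q, L (p, q) -> ~~ U (p - 1, q + 1)) ->
  (forall p q, L (p, q) -> l < p - q) ->
  (forall p q, U (p, q) -> p - q < u) ->
  valid_on G (fun c => ~~ L c && ~~ U c) x ->
  exists2 z : config A, graph_shift G z &
    forall c, ~~ L c -> ~~ U c -> z c = x c.
Proof.
move=> [HG HGt] HL HU sep levL levU Hx.
have [y yx Hy] := fill_SE HG HL HU sep levL Hx.
have [|||||z zy Hz] := @fill_SE _ _ (swap U) pred0 (- u) (swap y) HGt.
- by move=> p q /HU[].
- by [].
- by [].
- by move=> p q /(levU q p); lia.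
- by move=> p q; have [H1 H2] := valid_swap Hy p q; split; rewrite ?andbT.
exists (swap z) => [p q|[p q] Lc Uc]; last by rewrite /swap /= zy // -(yx (p, q)).
by have [H1 H2] := Hz q p; split; [apply: H2|apply: H1].
Qed.

(** * Gluing points of the shift space *)

Definition occurs (A : finType) (G : graph2 A) : Prop :=
  forall a, exists2 x, graph_shift G x & x (0, 0) = a.

(** On the row 0 the two quadrants leave no gap, so they form a separating
    region; the only edge between them is the one from [(0, 0)] to [(1, 0)]. *)
Lemma glue_hedge (A : finType) (G : graph2 A) (x y : config A) :
  fillable G -> graph_shift G x -> graph_shift G y ->
  hedge G (x (0, 0)) (y (0, 0)) ->
  exists z : config A, [/\ graph_shift G z,
    forall p q : int, p <= 0 -> q <= 0 -> z (p, q) = x (p, q) &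
    forall p q : int, 0 <= p -> 0 <= q -> z (1 + p, q) = y (p, q)].
Proof.
move=> HG Hx Hy hxy.
have [||||||z Hz zE] := @extend_to_plane _ G (fun c => (0 < c.1) && (c.2 < 0))
  (fun c => (c.1 <= 0) && (0 < c.2)) 1 0
  (fun c => if c.1 <= 0 then x c else y (c.1 - 1, c.2)) HG;
  try by move=> p q /=; lia.
- move=> p q /=; split.
  + move=> H1 H2; have [p0|[p0|p0]] : p < 0 \/ p = 0 \/ 0 < p by lia.
    * by rewrite !ifT; [have [] := Hx p q|lia|lia].
    * have -> : q = 0 by lia.
      rewrite p0.
      exact: hxy.
    * rewrite !ifF; [|lia|lia].
      by have [+ _] := Hy (p - 1) q; rewrite (_ : p + 1 - 1 = p - 1 + 1) //; lia.
  + move=> _ _; case: ifP => _; first by have [] := Hx p q.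
    by have [] := Hy (p - 1) q.
exists z; split=> // p q p0 q0; rewrite zE /=; try lia.
  by rewrite p0.
by rewrite ifF ?(addrC 1) ?addrK //; lia.
Qed.

(** In an essential graph [a] lies on a bi-infinite walk with alternating
    horizontal and vertical edges: written along the cells with [p - q = 0] or
    [p - q = 1] it is a separating staircase. *)
Lemma occurs_of_essential (A : finType) (G : graph2 A) :
  fillable G -> essential G -> occurs G.
Proof.
move=> HG [Hh Hv] a.
have /choice[nh nhP] : forall a, exists b, hedge G a b by move=> b; case: (Hh b).
have /choice[nv nvP] : forall a, exists b, vedge G a b by move=> b; case: (Hv b).
have /choice[ph phP] : forall a, exists b, hedge G b a by move=> b; case: (Hh b).
have /choice[pv pvP] : forall a, exists b, vedge G b a by move=> b; case: (Hv b).
(* d i is the symbol at (i, i) and m i the one at (i + 1, i). *)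
pose d (i : int) := match i with Posz n => iter n (nv \o nh) a
  | Negz n => iter n.+1 (ph \o pv) a end.
pose m (i : int) := match i with Posz n => nh (d n)
  | Negz n => pv (iter n (ph \o pv) a) end.
have dm i : hedge G (d i) (m i) by case: i => n //=; apply: phP.
have md i : vedge G (m i) (d (i + 1)).
  case: i => n; first by rewrite (_ : Posz n + 1 = Posz n.+1) //=; lia.
  case: n => [|n]; first by apply: pvP.
  by rewrite (_ : Negz n.+1 + 1 = Negz n) /=; [apply: pvP|lia].
have [||||||z Hz zE] := @extend_to_plane _ G (fun c => 1 < c.1 - c.2)
  (fun c => c.1 < c.2) 1 0
  (fun c => if c.1 == c.2 then d c.2 else m c.2) HG; try by move=> p q /=; lia.
- move=> p q /=; split=> H1 H2.
    have -> : p = q by lia.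
    by rewrite eqxx ifF //; lia.
  have -> : p = q + 1 by lia.
  by rewrite eqxx ifF //; lia.
by exists z; rewrite ?zE.
Qed.

(** * Supports of matrices *)

Definition same_support n (M N : 'M[nat]_n) : Prop :=
  forall i j, (M i j != 0) = (N i j != 0).

Lemma mulmx_neq0 n (M N : 'M[nat]_n) i j :
  ((M *m N) i j != 0) = [exists k, (M i k != 0) && (N k j != 0)].
Proof.
rewrite mxE [X in X != 0](_ : _ = (\sum_k (M i k * N k j))%N) //.
rewrite sum_nat_eq0 negb_forall; apply: eq_existsb => k.
by rewrite muln_eq0 negb_or.
Qed.

Lemma same_supportM n (M M' N N' : 'M[nat]_n) :
  same_support M M' -> same_support N N' ->
  same_support (M *m N) (M' *m N').
Proof.
move=> HM HN i j; rewrite !mulmx_neq0; apply: eq_existsb => k.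
by rewrite HM HN.
Qed.

Lemma same_supportXr n (M N : 'M[nat]_n) k :
  same_support (M *m N) (N *m M) -> same_support (M *m N ^+ k) (N ^+ k *m M).
Proof.
move=> MN; elim: k => [|k IH] i j; first by rewrite !expr0 mulmx1 mul1mx.
rewrite !exprS -!mulmxE mulmxA (same_supportM MN (fun _ _ => erefl)) -!mulmxA.
exact: same_supportM.
Qed.

Lemma same_supportX n (M N : 'M[nat]_n) k l :
  same_support (M *m N) (N *m M) ->
  same_support (M ^+ k *m N ^+ l) (N ^+ l *m M ^+ k).
Proof.
move=> /same_supportXr MN i j; by apply/esym/same_supportXr => {}i {}j; apply/esym/MN.
Qed.

(** Only the support matters for irreducibility, and on supports the powers of
    [M] can be collected to the left of those of [N]. *)
Lemma same_support_expM n (M N : 'M[nat]_n) r s k :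
  same_support (M *m N) (N *m M) ->
  same_support ((M ^+ r *m N ^+ s) ^+ k) (M ^+ (r * k) *m N ^+ (s * k)).
Proof.
move=> MN; elim: k => [|k IH] i j; first by rewrite !muln0 !expr0 mulmx1.
rewrite exprS -mulmxE (same_supportM (fun _ _ => erefl) IH) !mulnS !exprD -!mulmxE.
rewrite -!mulmxA; apply: same_supportM => // {}i {}j; rewrite !mulmxA.
by apply: same_supportM => // {}i {}j; apply/esym/same_supportX.
Qed.

Lemma adjmxE (A : finType) (e : rel A) i j :
  (adjmx e i j != 0) = e (enum_val i) (enum_val j).
Proof. by rewrite mxE; case: (e _ _). Qed.

(** * Walks and their gluing *)

Lemma hedge_pow (A : finType) (G : graph2 A) (x : config A) n (p q : int) :
  graph_shift G x ->
  (hadj G ^+ n) (enum_rank (x (p, q))) (enum_rank (x (p + n%:Z, q))) != 0.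
Proof.
move=> Hx; elim: n p => [|n IH] p.
  by rewrite expr0 addr0 mxE eqxx.
rewrite exprS -mulmxE mulmx_neq0; apply/existsP; exists (enum_rank (x (p + 1, q))).
rewrite adjmxE !enum_rankK; have [-> _] := Hx p q.
by have := IH (p + 1); rewrite (_ : p + 1 + n%:Z = p + n.+1%:Z) //; lia.
Qed.

Lemma vedge_pow (A : finType) (G : graph2 A) (x : config A) n (p q : int) :
  graph_shift G x ->
  (vadj G ^+ n) (enum_rank (x (p, q))) (enum_rank (x (p, q + n%:Z))) != 0.
Proof. by move=> /graph_shift_swap/(hedge_pow n q p). Qed.

(** The walk is prepended edge by edge to [y], starting from its end: each
    intermediate vertex is the symbol at the origin of some point, whose
    south-west quadrant is glued on, and the last edge brings in [x]. *)
Lemma glue_hwalk (A : finType) (G : graph2 A) (x y : config A) n :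
  fillable G -> occurs G -> graph_shift G x -> graph_shift G y ->
  (hadj G ^+ n.+1) (enum_rank (x (0, 0))) (enum_rank (y (0, 0))) != 0 ->
  exists z : config A, [/\ graph_shift G z,
    forall p q : int, p <= 0 -> q <= 0 -> z (p, q) = x (p, q) &
    forall p q : int, 0 <= p -> 0 <= q -> z (n.+1%:Z + p, q) = y (p, q)].
Proof.
move=> HG HO; elim: n x => [|n IH] x Hx Hy.
  by rewrite expr1 adjmxE !enum_rankK; apply: glue_hedge.
rewrite exprS -mulmxE mulmx_neq0 => /existsP[k /andP[]].
rewrite adjmxE enum_rankK; have [w Hw wE] := HO (enum_val k).
rewrite -wE => xw; rewrite -[k]enum_valK -wE => wy.
have [z1 [Hz1 z1w z1y]] := IH _ Hw Hy wy.
rewrite -(z1w 0 0) // in xw.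
have [z [Hz zx zz1]] := glue_hedge HG Hx Hz1 xw.
exists z; split=> // p q p0 q0.
rewrite (_ : _ + p = 1 + (n.+1%:Z + p)); last by lia.
by rewrite zz1 ?z1y //; lia.
Qed.

Lemma glue_vwalk (A : finType) (G : graph2 A) (x y : config A) n :
  fillable G -> occurs G -> graph_shift G x -> graph_shift G y ->
  (vadj G ^+ n.+1) (enum_rank (x (0, 0))) (enum_rank (y (0, 0))) != 0 ->
  exists z : config A, [/\ graph_shift G z,
    forall p q : int, p <= 0 -> q <= 0 -> z (p, q) = x (p, q) &
    forall p q : int, 0 <= p -> 0 <= q -> z (p, n.+1%:Z + q) = y (p, q)].
Proof.
move=> HG HO Hx Hy xy.
have HO' : occurs (transpose G).
  by move=> a; have [w Hw wa] := HO a; exists (swap w) => //; apply: graph_shift_swap.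
have [z [Hz zx zy]] := glue_hwalk (fillable_transpose HG) HO'
  (graph_shift_swap Hx) (graph_shift_swap Hy) xy.
exists (swap z); split=> [|p q p0 q0|p q p0 q0].
- by move=> p q; have [H1 H2] := Hz q p.
- by rewrite /swap zx.
- by rewrite /swap zy.
Qed.

Lemma glue_walk (A : finType) (G : graph2 A) (x y : config A) m n :
  fillable G -> occurs G -> graph_shift G x -> graph_shift G y ->
  (hadj G ^+ m.+1 *m vadj G ^+ n.+1)
    (enum_rank (x (0, 0))) (enum_rank (y (0, 0))) != 0 ->
  exists z : config A, [/\ graph_shift G z,
    forall p q : int, p <= 0 -> q <= 0 -> z (p, q) = x (p, q) &
    forall p q : int, 0 <= p -> 0 <= q ->
      z (m.+1%:Z + p, n.+1%:Z + q) = y (p, q)].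
Proof.
move=> HG HO Hx Hy; rewrite mulmx_neq0 => /existsP[k /andP[xk ky]].
have [w Hw wE] := HO (enum_val k).
rewrite -[k]enum_valK -wE in xk ky.
have [w' [Hw' w'w w'y]] := glue_vwalk HG HO Hw Hy ky.
rewrite -(w'w 0 0) // in xk.
have [z [Hz zx zw']] := glue_hwalk HG HO Hx Hw' xk.
by exists z; split=> // p q p0 q0; rewrite zw' ?w'y //; lia.
Qed.

(** * Open sets and transitivity *)

(** The sets that contain all configurations agreeing with [x] on some box form
    a filter converging to [x] coordinate by coordinate, hence in the product
    topology, so it contains every neighbourhood of [x]. *)
Lemma open_in_box (A : finType) (X U : set (config A)) (x : config A) :
  open_in X U -> U x -> exists N : nat, forall y : config A, X y ->
    (forall p q : int, `|p| <= N%:Z -> `|q| <= N%:Z -> y (p, q) = x (p, q)) ->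
    U y.
Proof.
move=> [/open_subspaceP[V oV VU] UX] Ux.
have Vx : V x by have : (U `&` X) x by [split=> //; apply: UX]; rewrite -VU => -[].
pose F : set_system (config A) := fun P => exists N : nat, forall y : config A,
  (forall p q : int, `|p| <= N%:Z -> `|q| <= N%:Z -> y (p, q) = x (p, q)) -> P y.
have FF : Filter F.
  split; first by exists 0%N.
  - move=> P Q [N HN] [M HM]; exists (N + M)%N => y Hy; split.
      by apply: HN => p q ? ?; apply: Hy; lia.
    by apply: HM => p q ? ?; apply: Hy; lia.
  - by move=> P Q PQ [N HN]; exists N => y /HN/PQ.
have Fx : F --> (x : config A).
  apply/cvg_sup => -[p q] D [C [[E oE <-] Ec]] /filterS; apply.
  exists (absz p + absz q)%N => y Hy; move: Ec; rewrite /= Hy //; lia.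
have [N HN] : F V by apply: Fx; apply: open_nbhs_nbhs.
exists N => y Xy /HN Vy.
by have : (V `&` X) y by []; rewrite VU => -[].
Qed.

Lemma open_in_cylinder (A : finType) (X : set (config A)) (a : A) :
  open_in X (X `&` [set x | x (0, 0) = a]).
Proof.
split; last by move=> x [].
rewrite setIC open_subspaceIT; apply: open_subspaceW.
have pc : continuous ((fun x => x (0, 0)) : config A -> discrete_topology A).
  by move=> x; apply: proj_continuous.
by have /continuousP/(_ [set a]) := pc; apply; apply: discrete_open.
Qed.

Definition transitive_shift (A : finType) (X : set (config A)) (r s : int) : Prop :=
  forall U W : set (config A),
    open_in X U -> U !=set0 -> open_in X W -> W !=set0 ->
    exists2 k : nat, (0 < k)%N & (shift (k%:Z * r, k%:Z * s) @` U) `&` W !=set0.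

Lemma shiftD (A : finType) (a b : int * int) (x : config A) :
  shift a (shift b x) = shift (a + b) x.
Proof. by apply/funext => k; rewrite /shift addrA. Qed.

(** A visit of [W] to [U] under a shift is a visit of [U] to [W] under the inverse
    shift. *)
Lemma doubly_transitiveE (A : finType) (X : set (config A)) (r s : int) :
  doubly_transitive X r s <-> transitive_shift X r s.
Proof.
split=> [T U W oU U0 oW W0|T U W oU U0 oW W0].
  by have [k [_ [k0 _ H _]]] := T U W oU U0 oW W0; exists k.
have [k k0 Hk] := T U W oU U0 oW W0.
have [l l0 [_ [[w Ww <-] Uw]]] := T W U oW W0 oU U0.
exists k, l; split=> //; exists w; split=> //.
exists (shift (l%:Z * r, l%:Z * s) w) => //.
rewrite shiftD (_ : _ + _ = 0); last by congr (_, _); rewrite /= addNr.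
by apply/funext => c; rewrite /shift addr0.
Qed.

Lemma shiftE (A : finType) (a b p q : int) (x : config A) :
  shift (a, b) x (p, q) = x (p + a, q + b).
Proof. by []. Qed.

Lemma graph_shift_shift (A : finType) (G : graph2 A) (a : int * int) (x : config A) :
  graph_shift G x -> graph_shift G (shift a x).
Proof.
move=> Hx p q; have [H1 H2] := Hx (p + a.1) (q + a.2).
rewrite /shift; split.
  by rewrite (_ : (p + 1, q) + a = (p + a.1 + 1, q + a.2)) //; congr (_, _); apply: addrAC.
by rewrite (_ : (p, q + 1) + a = (p + a.1, q + a.2 + 1)) //; congr (_, _); apply: addrAC.
Qed.

(** * Transitivity and irreducibility for positive exponents *)

Lemma irreducible_of_transitive (A : finType) (G : graph2 A) (r s : nat) :
  same_support (hadj G *m vadj G) (vadj G *m hadj G) -> occurs G ->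
  transitive_shift (graph_shift G) r%:Z s%:Z ->
  irreducible_mx (hadj G ^+ r *m vadj G ^+ s).
Proof.
move=> HV HO T i j.
have cyl (k : 'I_#|A|) : graph_shift G `&` [set x | x (0, 0) = enum_val k] !=set0.
  by have [x Hx xk] := HO (enum_val k); exists x.
have [k k0 [_ [[z [Hz zi] <-] [_ zj]]]] :=
  T _ _ (open_in_cylinder _ _) (cyl i) (open_in_cylinder _ _) (cyl j).
exists k; split=> //; rewrite same_support_expM // mulmx_neq0.
apply/existsP; exists (enum_rank (z (k%:Z * r%:Z, 0))).
have := hedge_pow (r * k) 0 0 Hz; rewrite add0r zi enum_valK PoszM mulrC => ->.
have := vedge_pow (s * k) (k%:Z * r%:Z) 0 Hz.
rewrite add0r PoszM (mulrC s%:Z); move: zj; rewrite /= shiftE !add0r => ->.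
by rewrite enum_valK.
Qed.

(** The two boxes are translated so that the cell [(Nr, Ns)] of [x] and the cell
    [(-Nr, -Ns)] of [y] become the corners to be joined.  Multiples of [(r, s)] are
    taken so that the total displacement is again a multiple of [(r, s)]. *)
Lemma transitive_of_irreducible (A : finType) (G : graph2 A) (r s : nat) :
  same_support (hadj G *m vadj G) (vadj G *m hadj G) -> occurs G -> fillable G ->
  (0 < r)%N -> (0 < s)%N ->
  irreducible_mx (hadj G ^+ r *m vadj G ^+ s) ->
  transitive_shift (graph_shift G) r%:Z s%:Z.
Proof.
move=> HV HO HG r0 s0 Hirr U W oU [x Ux] oW [y Wy].
have [N1 HU] := open_in_box oU Ux.
have [N2 HW] := open_in_box oW Wy.
have Xx : graph_shift G x by case: oU => _; apply.
have Xy : graph_shift G y by case: oW => _; apply.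
pose N := (N1 + N2)%N.
have Nr : (N <= N * r)%N by rewrite leq_pmulr.
have Ns : (N <= N * s)%N by rewrite leq_pmulr.
pose a := (N * r)%N; pose b := (N * s)%N.
have X1 := graph_shift_shift (a%:Z, b%:Z) Xx.
have Y1 := graph_shift_shift (- a%:Z, - b%:Z) Xy.
have [k [k0]] := Hirr (enum_rank (shift (a%:Z, b%:Z) x (0, 0)))
  (enum_rank (shift (- a%:Z, - b%:Z) y (0, 0))).
rewrite same_support_expM //.
rewrite -(@prednK (r * k)%N) ?muln_gt0 ?r0 // -(@prednK (s * k)%N) ?muln_gt0 ?s0 //.
move=> /(glue_walk HG HO X1 Y1)[z [Hz zx zy]].
rewrite !prednK ?muln_gt0 ?r0 ?s0 // in zy.
exists (k + N.*2)%N; first by rewrite addn_gt0 k0.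
exists (shift ((k + N.*2)%N%:Z * r%:Z, (k + N.*2)%N%:Z * s%:Z) (shift (- a%:Z, - b%:Z) z)).
split.
  eexists; [|reflexivity]; apply: HU; first exact: graph_shift_shift.
  move=> p q pN qN; rewrite shiftE zx; [|lia|lia].
  by rewrite shiftE !subrK.
rewrite shiftD; apply: HW; first exact: graph_shift_shift.
move=> p q pN qN.
have := zy (p + a%:Z) (q + b%:Z); rewrite !shiftE !addrK => <-; [|lia|lia].
congr z; congr (_, _); rewrite /= /a /b; lia.
Qed.

(** * Signs of the exponents *)

Lemma irreducible_same_support n (M N : 'M[nat]_n) :
  same_support M N -> irreducible_mx M -> irreducible_mx N.
Proof.
move=> MN Hirr i j; have [k [k0 Hk]] := Hirr i j; exists k; split=> //.
suff <- : ((M ^+ k) i j != 0) = ((N ^+ k) i j != 0) by [].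
elim: k i j {k0 Hk} => [//|k IH] i j; rewrite !exprS -!mulmxE.
exact: same_supportM.
Qed.

Lemma trmx_exp n (M : 'M[nat]_n) k : M^T ^+ k = (M ^+ k)^T.
Proof.
elim: k => [|k IH]; first by rewrite !expr0 trmx1.
by rewrite exprS exprSr IH -!mulmxE trmx_mul.
Qed.

Lemma irreducible_trmx n (M : 'M[nat]_n) : irreducible_mx M -> irreducible_mx M^T.
Proof.
by move=> Hirr i j; have [k [k0 Hk]] := Hirr j i; exists k; rewrite trmx_exp mxE.
Qed.

Lemma adjpow_pos n (M : 'M[nat]_n) (r : nat) : adjpow M r%:Z = M ^+ r.
Proof. by []. Qed.

Lemma adjpow_neg n (M : 'M[nat]_n) (r : nat) : adjpow M (- r.+1%:Z) = (M ^+ r.+1)^T.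
Proof. by rewrite -trmx_exp. Qed.

Lemma doubly_transitiveN (A : finType) (X : set (config A)) (r s : int) :
  doubly_transitive X r s -> doubly_transitive X (- r) (- s).
Proof.
move=> T U W oU U0 oW W0; have [k [l [k0 l0 Hk Hl]]] := T U W oU U0 oW W0.
by exists l, k; rewrite !mulrN !opprK.
Qed.

Unset Implicit Arguments.
Theorem proposition4 (A : finType) (G : graph2 A)
  (G_essential : essential G)
  (X_nonempty : graph_shift G !=set0)
  (HV_VH : forall i j : 'I_#|A|,
     (hadj G *m vadj G) i j != 0 <-> (vadj G *m hadj G) i j != 0)
  (r s : int) (rs_gt0 : 0 < r * s) :
  doubly_transitive (graph_shift G) r s <->
  irreducible_mx (adjpow (hadj G) r *m adjpow (vadj G) s).
Proof.
have HV : same_support (hadj G *m vadj G) (vadj G *m hadj G).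
  by move=> i j; apply/idP/idP => /HV_VH.
have HG : fillable G.
  split=> a b c ab bc.
    have : (vadj G *m hadj G) (enum_rank a) (enum_rank c) != 0.
      rewrite mulmx_neq0; apply/existsP; exists (enum_rank b).
      by rewrite !adjmxE !enum_rankK ab.
    rewrite -HV mulmx_neq0 => /existsP[k]; rewrite !adjmxE !enum_rankK => /andP[? ?].
    by exists (enum_val k).
  have : (hadj G *m vadj G) (enum_rank a) (enum_rank c) != 0.
    rewrite mulmx_neq0; apply/existsP; exists (enum_rank b).
    by rewrite !adjmxE !enum_rankK; apply/andP.
  rewrite HV mulmx_neq0 => /existsP[k]; rewrite !adjmxE !enum_rankK => /andP[? ?].
  by exists (enum_val k).
have HO := occurs_of_essential HG G_essential.
have pos (m n : nat) : (0 < m)%N -> (0 < n)%N ->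
    doubly_transitive (graph_shift G) m%:Z n%:Z <->
    irreducible_mx (hadj G ^+ m *m vadj G ^+ n).
  move=> m0 n0; rewrite doubly_transitiveE; split.
    exact: irreducible_of_transitive.
  exact: transitive_of_irreducible.
have [[r0 s0]|[r0 s0]] : 0 < r /\ 0 < s \/ r < 0 /\ s < 0.
  move: rs_gt0; case: (ltrgtP r 0) => [r0|r0|->]; last by rewrite mul0r.
    by rewrite nmulr_rgt0 //; right.
  by rewrite pmulr_rgt0 //; left.
  case: r r0 {rs_gt0} => // r r0; case: s s0 => // s s0.
  by rewrite !adjpow_pos; apply: pos.
have [m ->] : exists m : nat, r = - m.+1%:Z by exists `|r|.-1%N; lia.
have [n ->] : exists n : nat, s = - n.+1%:Z by exists `|s|.-1%N; lia.
rewrite !adjpow_neg -trmx_mul.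
have VH := same_supportX m.+1 n.+1 HV.
split=> [/doubly_transitiveN|].
  rewrite !opprK => /pos-/(_ isT isT).
  by move=> /(irreducible_same_support VH)/irreducible_trmx.
move=> /irreducible_trmx; rewrite trmxK => Hirr.
apply: doubly_transitiveN; apply/pos => //.
by apply: irreducible_same_support Hirr => i j; rewrite VH.
Qed.
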